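(* Let $w=w_1\cdots w_n$ be a fixed word of length $n\ge 2$. If $w_i=w_{n-i+1}$ for all $1\le i\le n$, then $\lim_{d\to\infty}\frac{f(w,d)}{\frac12(n+2)^d}=1$; otherwise $\lim_{d\to\infty}\frac{f(w,d)}{\frac14(n+2)^d}=1$.
   Context: Let $[n]=\{1,\dots,n\}$, $n\ge 2$, $d\ge 1$. For $p\in[n]^d$ and $v\in\{-1,0,1\}^d$ with $v\ne\vec 0$, if $p+tv\in[n]^d$ for all $0\le t\le n-1$, the set $\ell=\{p,p+v,\dots,p+(n-1)v\}$ is called a line (with initial point $p$ and direction $v$). Each line has a unique representation $(p;v)$ in which the first nonzero coordinate of $v$ is $+1$ (its canonical pair); for such a representation write $\ell_i=p+(i-1)v$ for $1\le i\le n$. An $(n,d)$-grid is a function $G:[n]^d\to\Sigma$ for an arbitrary set of letters $\Sigma$. For a word $w=w_1\cdots w_n$, a line $\ell$ contains $w$ if $G(\ell_1)G(\ell_2)\cdots G(\ell_n)=w$ or $G(\ell_n)\cdots G(\ell_1)=w$. $f(w,G)$ is the number of lines of $[n]^d$ containing $w$, and $f(w,d)=\max_G f(w,G)$ over all $(n,d)$-grids $G$. *)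

(* Defs.v *)
From HB Require Import structures.
From mathcomp Require Import all_boot all_order all_algebra.
From mathcomp Require Import boolp classical_sets reals topology normedtype sequences.
Set Implicit Arguments. Unset Strict Implicit. Unset Printing Implicit Defensive.
Import Order.TTheory GRing.Theory Num.Theory.
Local Open Scope ring_scope.

(* Coordinates of [n] = {1..n} are represented 0-based by 'I_n;
   points of [n]^d are finite functions 'I_d -> 'I_n. *)
Notation point d n := {ffun 'I_d -> 'I_n}.

(* A direction v in {-1,0,1}^d is encoded by u : {ffun 'I_d -> 'I_3},
   with v_i = u_i - 1. *)
Definition dir d (u : {ffun 'I_d -> 'I_3}) (i : 'I_d) : int := (u i)%:Z - 1.

Definition dir_nonzero d (u : {ffun 'I_d -> 'I_3}) : bool :=
  [exists i, dir u i != 0].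

Definition dir_canonical d (u : {ffun 'I_d -> 'I_3}) : bool :=
  [exists i, (dir u i == 1) && [forall j : 'I_d, (j < i)%N ==> (dir u j == 0)]].

Definition coord d n (p : point d n) (u : {ffun 'I_d -> 'I_3}) (t : nat) (i : 'I_d) : int :=
  (p i)%:Z + t%:Z * dir u i.

Definition in_range d n (p : point d n) (u : {ffun 'I_d -> 'I_3}) : bool :=
  [forall t : 'I_n, [forall i, (0 <= coord p u t i) && (coord p u t i < n%:Z)]].

(* the point p + t v as an element of [n]^d (meaningful when in range) *)
Definition lpt d n (p : point d n) (u : {ffun 'I_d -> 'I_3}) (t : nat) : point d n :=
  [ffun i => insubd (p i) `|coord p u t i|%N].

Definition line_of d n (p : point d n) (u : {ffun 'I_d -> 'I_3}) : {set point d n} :=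
  [set lpt p u t | t : 'I_n].

Definition contains_word (T : eqType) d n (w : n.-tuple T) (G : point d n -> T)
    (L : {set point d n}) : bool :=
  [exists p : point d n, exists u : {ffun 'I_d -> 'I_3},
    [&& dir_nonzero u, dir_canonical u, in_range p u, L == line_of p u &
      [forall k : 'I_n, G (lpt p u k) == tnth w k]
      || [forall k : 'I_n, G (lpt p u (n - 1 - k)%N) == tnth w k]]].

Definition fG (T : eqType) d n (w : n.-tuple T) (G : point d n -> T) : nat :=
  #|[set L : {set point d n} | contains_word w G L]|.

(* f(w,d) = max_G f(w,G), over all (n,d)-grids G : [n]^d -> T.  The values
   f(w,G) are bounded by the number of sets of points, so this is a finite max. *)
Definition fd (T : eqType) n (w : n.-tuple T) (d : nat) : nat :=
  \max_(k < #|{: {set {set point d n}}}|.+1 | `[< exists G : point d n -> T, fG w G = k >]) k.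

(* Main.v *)
(** A line with its orientation is a word (template) over the alphabet
    [n] + {+, -} with at least one moving letter, and its k-th point substitutes
    k for + and n + 1 - k for -; exchanging + and - reverses the line.  So twice
    f(w, G) counts the moving templates along which G reads w in one of the two
    directions, which gives the upper bound (n + 2)^d / 2.

    If w_i <> w_(n+1-i), then t |-> (t(i), t(n+1-i)) is a bijection from templates
    to pairs of points that agree after identifying the letters i and n + 1 - i.
    Scoring a point 1, -1 or 0 according to whether G gives it w_i, w_(n+1-i) or
    neither, the sum over templates of the product of the scores of t(i) and
    t(n+1-i) is a sum of squares, hence nonnegative; so at most half of the
    templates have opposite letters at these two positions.

    For the lower bounds, in all but O(1/d) of the templates every symbol occurs
    about d/(n+2) times (Chebyshev), and then exactly the letters k and n + 1 - k
    are unusually frequent in the k-th point of the line, so that the grid can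
    recover {k, n + 1 - k} from the point.  To choose between w_k and w_(n+1-k) it
    uses the parity of the number of coordinates in the lower half of [n]: the two
    halves of a line have opposite parities as soon as its number of moving
    coordinates is odd, which holds for asymptotically half of the templates. *)

Require Import Defs.
From HB Require Import structures.
From mathcomp Require Import all_boot all_order all_algebra.
From mathcomp Require Import boolp classical_sets reals topology normedtype sequences.
From mathcomp Require Import zify ring.
Import Order.TTheory GRing.Theory Num.Theory.
Import numFieldNormedType.Exports.
Local Open Scope ring_scope.

Set Implicit Arguments.
Unset Strict Implicit.
Unset Printing Implicit Defensive.

(* MathComp-Analysis shadows the notation [point] of Defs. *)
Notation gpoint d n := {ffun 'I_d -> 'I_n}.
(* [inl a] is the constant letter a, [inr true] is + and [inr false] is -. *)
Notation template d n := {ffun 'I_d -> 'I_n + bool}.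

(** * Lines and their templates *)

Definition subst_sym n (k : 'I_n) (c : 'I_n + bool) : 'I_n :=
  match c with inl a => a | inr b => if b then k else rev_ord k end.

Definition subst d n (t : template d n) (k : 'I_n) : gpoint d n :=
  [ffun j => subst_sym k (t j)].

Definition tdir d n (t : template d n) : {ffun 'I_d -> 'I_3} :=
  [ffun j => match t j with inl _ => inord 1 | inr b => if b then inord 2 else ord0 end].

Definition template_of d n (p : gpoint d n) (u : {ffun 'I_d -> 'I_3}) : template d n :=
  [ffun j => if dir u j == 0 then inl (p j) else inr (dir u j == 1)].

Definition flip_sym n (c : 'I_n + bool) : 'I_n + bool :=
  match c with inl a => inl a | inr b => inr (~~ b) end.

Definition flip d n (t : template d n) : template d n := [ffun j => flip_sym (t j)].

Definition moves n (c : 'I_n + bool) : bool := if c is inr _ then true else false.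

Definition canonical d n (t : template d n) : bool := dir_canonical (tdir t).

Lemma dir_tdir d n (t : template d n) (j : 'I_d) :
  dir (tdir t) j = match t j with inl _ => 0 | inr b => if b then 1 else -1 end.
Proof. by rewrite /dir ffunE; case: (t j) => [a|[]]; rewrite ?inordK. Qed.

Lemma coord_template d n (t : template d n.+1) (k : nat) (j : 'I_d) : (k < n.+1)%N ->
  Defs.coord (subst t ord0) (tdir t) k j = (subst t (inord k) j)%:Z.
Proof.
move=> kn; rewrite /Defs.coord dir_tdir !ffunE.
case: (t j) => [a|[]] /=; rewrite ?inordK //; first by rewrite mulr0 addr0.
  by rewrite add0r mulr1.
by lia.
Qed.

Lemma lpt_template d n (t : template d n.+1) (k : nat) : (k < n.+1)%N ->
  lpt (subst t ord0) (tdir t) k = subst t (inord k).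
Proof.
move=> kn; apply/ffunP=> j; rewrite ffunE coord_template // absz_nat.
by apply/val_inj; rewrite val_insubd ltn_ord.
Qed.

Lemma in_range_template d n (t : template d n.+1) :
  in_range (subst t ord0) (tdir t).
Proof.
apply/forallP=> k; apply/forallP=> j.
by rewrite coord_template // ?ltz_nat ?ltn_ord.
Qed.

Lemma dir_cases d (u : {ffun 'I_d -> 'I_3}) j : [\/ dir u j = 0, dir u j = 1 | dir u j = -1].
Proof.
rewrite /dir; case: (u j) => [[|[|[|k]]]] //= _; [exact: Or33|exact: Or31|exact: Or32].
Qed.

Lemma dir_inj d (u v : {ffun 'I_d -> 'I_3}) : dir u =1 dir v -> u = v.
Proof.
move=> e; apply/ffunP=> j; apply/val_inj.
have := e j; rewrite /dir => /addIr; by case.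
Qed.

Lemma subst_template_of d n (p : gpoint d n.+1) u : in_range p u ->
  subst (template_of p u) ord0 = p /\ tdir (template_of p u) = u.
Proof.
move=> /forallP hr; split; last first.
  apply: dir_inj => j; rewrite dir_tdir ffunE.
  by case: (dir_cases u j) => ->.
apply/ffunP=> j; apply/val_inj; rewrite !ffunE.
(* Being in range at the last point forces an increasing coordinate to start at the least letter and
   a decreasing one at the greatest. *)
have /forallP/(_ j)/andP[h0 h1] := hr ord_max.
have hp := ltn_ord (p j); move: h0 h1; rewrite /Defs.coord /=.
by case: (dir_cases u j) => -> /=; lia.
Qed.

Lemma subst_flip d n (t : template d n) k :
  subst (flip t) k = subst t (rev_ord k).
Proof. by apply/ffunP=> j; rewrite !ffunE; case: (t j) => [a|[]] //=; rewrite rev_ordK. Qed.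

Lemma flipK d n : involutive (@flip d n).
Proof. by move=> t; apply/ffunP=> j; rewrite !ffunE; case: (t j) => [a|[]]. Qed.

Lemma canonicalP d n (t : template d n) :
  reflect (exists i, t i = inr true /\ forall j : 'I_d, (j < i)%N -> ~~ moves (t j)) (canonical t).
Proof.
have h0 j : (dir (tdir t) j == 0) = ~~ moves (t j).
  by rewrite dir_tdir; case: (t j) => [a|[]].
have h1 j : (dir (tdir t) j == 1) = (t j == inr true).
  by rewrite dir_tdir; case: (t j) => [a|[]].
apply: (iffP existsP) => -[i].
  rewrite h1 => /andP[/eqP ti /forallP ni]; exists i; split=> // j ji.
  by have /implyP/(_ ji) := ni j; rewrite h0.
move=> [ti ni]; exists i; rewrite h1 ti eqxx /=.
by apply/forallP=> j; apply/implyP=> /ni; rewrite h0.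
Qed.

Lemma canonical_moves d n (t : template d n) : canonical t -> [exists j, moves (t j)].
Proof. by move=> /canonicalP[i [ti _]]; apply/existsP; exists i; rewrite ti. Qed.

Lemma moves_flip d n (t : template d n) (j : 'I_d) : moves (flip t j) = moves (t j).
Proof. by rewrite ffunE; case: (t j). Qed.

(** A flip keeps the first moving coordinate and changes its sign. *)
Lemma canonical_flip d n (t : template d n) : [exists j, moves (t j)] ->
  canonical (flip t) = ~~ canonical t.
Proof.
move=> /existsP[j0 hj0].
case: (@arg_minnP _ j0 (fun j => moves (t j)) (fun j : 'I_d => val j) hj0) => i ti mini.
have mi (j : 'I_d) : (j < i)%N -> ~~ moves (t j).
  by move=> ji; apply/negP=> /mini; rewrite leqNgt ji.
have key (s : template d n) : moves (s i) -> (forall j : 'I_d, (j < i)%N -> ~~ moves (s j)) ->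
    canonical s = (s i == inr true).
  move=> si ms; apply/canonicalP/eqP=> [[i' [si' mi']]|]; last by exists i.
  case: (ltngtP i i') => [/mi'|/ms|/val_inj ->] //; first by rewrite si.
  by rewrite si'.
rewrite !key ?moves_flip // => [|j /mi]; last by rewrite moves_flip.
by rewrite ffunE; case: (t i) ti => [a|[]].
Qed.

Definition tline d n (t : template d n) : {set gpoint d n} := [set subst t k | k : 'I_n].

Lemma line_of_template d n (t : template d n.+1) :
  line_of (subst t ord0) (tdir t) = tline t.
Proof. by apply: eq_imset => k; rewrite lpt_template // inord_val. Qed.

(** With at least two letters, a coordinate is constant on the point set exactly when it does not
    move, so the set determines the moving coordinates. The first of them is + in both templates,
    hence the initial points agree, and these determine the remaining symbols. *)
Lemma tline_inj d n (s t : template d n.+2) : canonical s -> canonical t ->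
  tline s = tline t -> s = t.
Proof.
wlog suff sub : s t / canonical s -> canonical t ->
    tline s = tline t ->
    forall j, ~~ moves (t j) -> s j = t j.
  move=> cs ct e.
  have st := sub _ _ cs ct e; have ts := sub _ _ ct cs (esym e).
  have mv j : moves (s j) = moves (t j).
    apply/idP/idP; apply: contraTT => h; first by rewrite st.
    by rewrite ts.
  have /canonicalP[i [si mi]] := cs; have /canonicalP[i' [ti mi']] := ct.
  have ii' : i = i'.
    apply/val_inj; case: (ltngtP i i') => // [/mi'|/mi]; first by rewrite -mv si.
    by rewrite mv ti.
  subst i'.
  have : subst s ord0 \in tline t by rewrite -e; apply: imset_f.
  move=> /imsetP[k _ ek].
  have k0 : k = ord0 by have /ffunP/(_ i) := ek; rewrite !ffunE si ti.
  rewrite k0 in ek; apply/ffunP=> j; have := mv j; have /ffunP/(_ j) := ek; rewrite !ffunE.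
  by case: (s j) (t j) => [a|[]] [b|[]] //= -> .
move=> cs ct e j.
case tj: (t j) => [a|] // _.
have h k : subst s k j = a.
  have : subst s k \in tline t by rewrite -e; apply: imset_f.
  by move=> /imsetP[k' _ ->]; rewrite ffunE tj.
have := h ord0; have := h ord_max; rewrite !ffunE.
case: (s j) => [b|[]] /= => [_ -> //|<-|<-] /(congr1 val) /=; lia.
Qed.

Definition hits (T : eqType) d n (w : n.-tuple T) (G : gpoint d n -> T) (t : template d n) :=
  [forall k, G (subst t k) == tnth w k]
  || [forall k, G (subst t (rev_ord k)) == tnth w k].

Lemma contains_wordP (T : eqType) d n (w : n.+1.-tuple T) (G : gpoint d n.+1 -> T) L :
  reflect (exists t, [/\ canonical t, hits w G t & L = tline t])
    (contains_word w G L).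
Proof.
have hE t : [forall k : 'I_n.+1,
        G (lpt (subst t ord0) (tdir t) k) == tnth w k]
    || [forall k : 'I_n.+1,
        G (lpt (subst t ord0) (tdir t) (n.+1 - 1 - k)%N) == tnth w k]
    = hits w G t.
  congr (_ || _); apply: eq_forallb => k; rewrite lpt_template ?inord_val //; last by lia.
  do 3 f_equal; apply/val_inj; rewrite /= inordK; lia.
apply: (iffP existsP).
  move=> [p /existsP[u /and5P[_ cu ir /eqP eL hw]]].
  have [ep eu] := subst_template_of ir.
  exists (template_of p u); rewrite /canonical -hE -line_of_template ep eu.
  by split.
move=> [t [ct ht eL]]; exists (subst t ord0); apply/existsP; exists (tdir t).
apply/and5P; split=> //; last by rewrite hE.
- have /existsP[i /andP[/eqP hi _]] := ct; by apply/existsP; exists i; rewrite hi.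
- exact: in_range_template.
- by rewrite line_of_template eL.
Qed.

Lemma hits_flip (T : eqType) d n (w : n.-tuple T) (G : gpoint d n -> T) t :
  hits w G (flip t) = hits w G t.
Proof.
rewrite /hits orbC; congr (_ || _); apply: eq_forallb => k; rewrite subst_flip //.
by rewrite rev_ordK.
Qed.

(** Canonical templates that hit [w] correspond to lines, and [flip] pairs them with the
    non-canonical moving ones. *)
Lemma double_fG (T : eqType) d n (w : n.+2.-tuple T) (G : gpoint d n.+2 -> T) :
  (2 * fG w G)%N =
  #|[set t : template d n.+2 | [exists j, moves (t j)] && hits w G t]|.
Proof.
set M := [set t | _].
set C := [set t : template d n.+2 | canonical t && hits w G t].
have -> : fG w G = #|C|.
  rewrite /fG -(card_in_imset (f := @tline d n.+2) (D := C)).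
    apply: eq_card => L; rewrite inE; apply/contains_wordP/imsetP.
      by move=> [t [ct ht ->]]; exists t; rewrite ?inE ?ct.
    by move=> [t]; rewrite inE => /andP[ct ht] ->; exists t.
  move=> s t; rewrite !inE => /andP[cs _] /andP[ct _]; exact: tline_inj.
have CM : C \subset M.
  by apply/fintype.subsetP=> t; rewrite !inE => /andP[/canonical_moves -> ->].
rewrite mul2n -addnn -(cardsID C M) (finset.setIidPr CM); congr addn.
rewrite -(card_imset _ (can_inj (@flipK d n.+2))); apply: eq_card => t.
rewrite !inE; apply/imsetP/idP.
  move=> [s]; rewrite inE => /andP[cs hs] ->; rewrite hits_flip hs !andbT.
  have ms := canonical_moves cs; rewrite canonical_flip // cs /=.
  by have /existsP[j hj] := ms; apply/existsP; exists j; rewrite moves_flip.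
move=> /andP[nc /andP[mt ht]]; exists (flip t); last by rewrite flipK.
by rewrite inE hits_flip ht andbT canonical_flip //; move: nc; rewrite ht andbT.
Qed.

(** * Upper bound by positivity *)

Lemma card_template d n : #|{: template d n}| = ((n + 2) ^ d)%N.
Proof. by rewrite card_ffun card_sum card_ord card_bool card_ord. Qed.

Lemma sum_subst_ge0 d n (s : gpoint d n -> int) (i : 'I_n) : i != rev_ord i ->
  0 <= \sum_(t : template d n) s (subst t i) * s (subst t (rev_ord i)).
Proof.
move=> ii'; set i' := rev_ord i in ii' *.
pose q a := if a == i' then i else a.
pose qq (x : gpoint d n) : gpoint d n := [ffun j => q (x j)].
(* Inverse of [t |-> (subst t i, subst t i')]: unequal letters with the same image under [q] are [i]
   and [i'], and their order decides between + and -. *)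
pose h (p : gpoint d n * gpoint d n) : template d n :=
  [ffun j => if p.1 j == p.2 j then inl (p.1 j) else inr (p.1 j == i)].
have -> : \sum_(t : template d n) s (subst t i) * s (subst t i')
    = \sum_(p | qq p.1 == qq p.2) s p.1 * s p.2.
  rewrite (reindex_onto (fun t => (subst t i, subst t i')) h) => [|[x y]] /=.
    apply: eq_bigl => t; apply/esym/andP; split; apply/eqP/ffunP=> j; rewrite !ffunE /=.
      by case: (t j) => [a|[]] //=; rewrite /q ?rev_ordK ?eqxx ?(negPf ii').
    case: (t j) => [a|[]] /=; first by rewrite eqxx.
      by rewrite (negPf ii') eqxx.
    by rewrite rev_ordK eq_sym (negPf ii').
  have key a b : q a = q b -> let c := if a == b then inl a else inr (a == i) in
      subst_sym i c = a /\ subst_sym i' c = b.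
    rewrite /q; have [->|ab] /= := eqVneq a b; first by [].
    case: (eqVneq a i') => ai'; case: (eqVneq b i') => bi' e.
    - by rewrite ai' bi' eqxx in ab.
    - by rewrite ai' -e eq_sym (negPf ii') /= rev_ordK.
    - by rewrite e eqxx /= bi'.
    - by rewrite e eqxx in ab.
  move=> /eqP/ffunP e; congr pair; apply/ffunP=> j; have := e j; rewrite !ffunE => /key /=.
    by case.
  by case.
(* Grouping the pairs by their common class [z] gives a sum of squares. *)
rewrite (partition_big (fun p => qq p.1) predT) //=; apply: sumr_ge0 => z _.
rewrite (_ : \sum_(p | _) _ = (\sum_(x | qq x == z) s x) ^+ 2) ?sqr_ge0 //.
rewrite expr2 big_distrlr /= pair_big /=; apply: eq_bigl => p.
by rewrite andbC; case: eqP => //= ->; rewrite eq_sym.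
Qed.

Lemma card_hits_le (T : eqType) d n (w : n.-tuple T) (G : gpoint d n -> T) (i : 'I_n) :
  tnth w i != tnth w (rev_ord i) ->
  (2 * #|[set t : template d n | hits w G t]| <= (n + 2) ^ d)%N.
Proof.
move=> wi; have ii' : i != rev_ord i by apply: contraNneq wi => <-.
pose s x : int := (G x == tnth w i)%:R - (G x == tnth w (rev_ord i))%:R.
pose F (t : template d n) := s (subst t i) * s (subst t (rev_ord i)).
have sb x : -1 <= s x <= 1 by rewrite /s; do 2 case: (_ == _).
rewrite -card_template -lez_nat PoszM -sum1_card -[#|{: _}|]sum1_card.
rewrite -!natz !natr_sum /= mulr_sumr.
have := sum_subst_ge0 s ii'; rewrite -/F => F0.
(* Twice the indicator of a hit is at most [1 - F t]: a hit has scores 1 and -1, so [F t = -1], and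
   [F t <= 1] always. *)
apply: (@le_trans _ _ (\sum_t (1 - F t))); last first.
  by rewrite sumrB lerBlDr lerDl.
rewrite big_mkcond /=; apply: ler_sum => t _; rewrite inE.
have := sb (subst t i); have := sb (subst t (rev_ord i)).
case: ifP => [|_]; last by rewrite /F; nia.
move=> ht _ _; suff -> : F t = -1 by [].
rewrite /F /s; case/orP: ht => /forallP ht.
  rewrite (eqP (ht i)) (eqP (ht (rev_ord i))) !eqxx (negPf wi) eq_sym (negPf wi); done.
have := ht (rev_ord i); rewrite rev_ordK => /eqP ->; rewrite (eqP (ht i)).
by rewrite !eqxx (negPf wi) eq_sym (negPf wi).
Qed.

(** * Chebyshev's inequality for symbol frequencies *)

Lemma sum_sqr_sum_ffun (S : finType) (X : S -> int) d : \sum_c X c = 0 ->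
  \sum_(t : {ffun 'I_d -> S}) (\sum_j X (t j)) ^+ 2
  = \sum_(j < d) \sum_(t : {ffun 'I_d -> S}) X (t j) ^+ 2.
Proof.
move=> X0; under eq_bigr do rewrite expr2 big_distrlr /=.
rewrite exchange_big; apply: eq_bigr => j _ /=; rewrite exchange_big (bigD1 j) //=.
rewrite [X in _ + X]big1 ?addr0 //= => k kj.
(* The cross term for [k != j] factors over the coordinates, and its factor at [j] is
   [\sum_c X c = 0]. *)
pose F i c := (if i == j then X c else 1) * (if i == k then X c else 1).
transitivity (\sum_(t : {ffun 'I_d -> S}) \prod_i F i (t i)).
  by apply: eq_bigr => t _; rewrite big_split /= -!big_mkcond /= !big_pred1_eq.
rewrite -bigA_distr_bigA (bigD1 j) //= [X in X * _](_ : _ = 0) ?mul0r //.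
by apply: etrans X0; apply: eq_bigr => c _; rewrite /F eqxx eq_sym (negPf kj) mulr1.
Qed.

Lemma sumz_nat (I : finType) (F : I -> nat) : \sum_i (F i)%:Z = (\sum_i F i)%N%:Z.
Proof. by rewrite -natz natr_sum; apply: eq_bigr => i _; rewrite natz. Qed.

Lemma card_setE (S : finType) (P : pred S) : #|[set x | P x]| = (\sum_x P x)%N.
Proof. by rewrite cardsE -sum1_card big_mkcond. Qed.

Definition occ (S : finType) d (t : {ffun 'I_d -> S}) (c : S) : nat := \sum_j (t j == c).

(* The thresholds 3/4 and 5/4 are those that separate the frequencies of the letters
   k and n + 1 - k, above 2 * 3/4, from the others, below 5/4, in [frequent]. *)
Definition unbalanced (S : finType) d (t : {ffun 'I_d -> S}) (c : S) : bool :=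
  (4 * #|S| * occ t c <= 3 * d)%N || (5 * d <= 4 * #|S| * occ t c)%N.

Lemma card_unbalanced (S : finType) d (c : S) :
  (d * #|[set t : {ffun 'I_d -> S} | unbalanced t c]| <= 16 * #|S| ^ 2 * #|S| ^ d)%N.
Proof.
have [->|d0] := posnP d; first by [].
set m := #|S|; set B := [set t | _].
have m0 : (0 < m)%N by apply/card_gt0P; exists c.
pose X c' : int := m%:Z * (c' == c)%:Z - 1.
have X0 : \sum_c' X c' = 0.
  rewrite sumrB -mulr_sumr sumz_nat.
  rewrite (bigD1 c) //= eqxx big1 => [|c' /negPf -> //].
  by rewrite addn0 mulr1 sumr_const natz subrr.
have XE (t : {ffun 'I_d -> S}) : \sum_j X (t j) = m%:Z * (occ t c)%:Z - d%:Z.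
  by rewrite sumrB -mulr_sumr sumz_nat sumr_const card_ord natz.
have := sum_sqr_sum_ffun d X0; set L := \sum_t _ => LE.
have L1 : L <= d%:Z * (m ^ 2 * m ^ d)%N%:Z.
  rewrite LE; apply: (@le_trans _ _ (\sum_(j < d) \sum_(t : {ffun 'I_d -> S}) (m ^ 2)%N%:Z)).
    apply: ler_sum => j _; apply: ler_sum => t _; rewrite /X; case: (_ == _); nia.
  by rewrite !sumr_const card_ffun card_ord -mulrnA -mulr_natr natz -!PoszM lez_nat -/m; nia.
(* If [c] is unbalanced in [t], the sum of the [X (t j)] is at least d/4 in absolute value, whence
   the factor 16. *)
have L2 : d%:Z ^+ 2 * (#|B|)%:Z <= 16 * L.
  rewrite /B card_setE -sumz_nat !mulr_sumr; apply: ler_sum => t _; rewrite XE /unbalanced -/m.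
  case: (boolP (_ || _)) => [|_]; last by rewrite mulr0 mulr_ge0 ?sqr_ge0.
  by rewrite mulr1; move: (occ t c) => x; nia.
have : d%:Z * (d%:Z * (#|B|)%:Z) <= d%:Z * (16 * (m ^ 2 * m ^ d)%N%:Z) by nia.
by rewrite ler_pM2l ?ltz_nat // ; lia.
Qed.

(** * Parity of the number of moving coordinates *)

Lemma sum_sign_moves d n :
  \sum_(t : template d n.+2) (-1) ^+ (\sum_j moves (t j)) = (n ^ d)%N%:Z.
Proof.
transitivity (\sum_(t : template d n.+2) \prod_j ((-1) ^+ moves (t j) : int)).
  by apply: eq_bigr => t _; rewrite -expr_sum.
rewrite -(bigA_distr_bigA (fun (j : 'I_d) (c : 'I_n.+2 + bool) => (-1) ^+ moves c : int)) /=.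
rewrite prodr_const card_ord big_sumType /= !sumr_const card_ord card_bool.
(* Each coordinate contributes the factor (n + 2) - 2: constant letters count 1, the two signs
   -1. *)
rewrite [X in X ^+ _](_ : _ = n%:Z); first by rewrite -[RHS]natz natrX natz.
by rewrite expr0 expr1 natz; lia.
Qed.

(** Makes the excess [n ^ d] of even over odd templates an error of relative order 1/d. *)
Lemma mul_exp_le a d : (d * a ^ d <= a * (a + 4) ^ d)%N.
Proof.
elim: d => [|d IH]; first by [].
have h : (a ^ d <= (a + 4) ^ d)%N by case: d {IH} => [|d]; rewrite // leq_exp2r // leq_addr.
rewrite !expnS; nia.
Qed.

Lemma card_even_moves d n :
  (2 * #|[set t : template d n.+2 | ~~ odd (\sum_j moves (t j))]| = (n.+2 + 2) ^ d + n ^ d)%N.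
Proof.
apply/eqP; rewrite -eqz_nat PoszM PoszD -(sum_sign_moves d n) card_setE -card_template.
rewrite -[#|{: _}|]sum1_card -!sumz_nat mulr_sumr -big_split /=; apply/eqP/eq_bigr => t _.
by rewrite -signr_odd; case: odd.
Qed.

(** * The winning grid *)

Lemma occ_subst d n (t : template d n) k i :
  occ (subst t k) i =
  (occ t (inl i) + (k == i) * occ t (inr true) + (rev_ord k == i) * occ t (inr false))%N.
Proof.
rewrite /occ !big_distrr -!big_split /=; apply: eq_bigr => j _; rewrite ffunE.
by case: (t j) => [a|[]] /=; rewrite ?muln0 ?muln1 ?addn0 ?add0n.
Qed.

Lemma sum_moves d n (t : template d n) :
  (\sum_j moves (t j) = occ t (inr true) + occ t (inr false))%N.
Proof. by rewrite /occ -big_split; apply: eq_bigr => j _; case: (t j) => [a|[]]. Qed.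

Definition lower_half n (a : 'I_n) : bool := (a < rev_ord a)%N.

Definition count_lower d n (x : gpoint d n) : nat := \sum_j lower_half (x j).

Lemma count_lower_subst d n (t : template d n) k :
  count_lower (subst t k) =
  (\sum_j (if t j is inl a then lower_half a else false)
   + lower_half k * occ t (inr true) + lower_half (rev_ord k) * occ t (inr false))%N.
Proof.
rewrite /count_lower /occ !big_distrr -!big_split /=; apply: eq_bigr => j _; rewrite ffunE.
by case: (t j) => [a|[]] /=; rewrite ?muln0 ?muln1 ?addn0 ?add0n.
Qed.

Definition balanced (S : finType) d (t : {ffun 'I_d -> S}) : bool :=
  [forall c, ~~ unbalanced t c].

Definition frequent d n (x : gpoint d n) (i : 'I_n) : bool :=
  (3 * d <= 2 * (n + 2) * occ x i)%N.

(** The letters [k] and [rev_ord k] gather the occurrences of at least two symbols, over 3/2 of the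
    mean d/(n + 2); any other letter has only its constant symbol, below 5/4 of the mean. *)
Lemma frequent_subst d n (t : template d n) k i : (0 < d)%N -> balanced t ->
  frequent (subst t k) i = (k == i) || (rev_ord k == i).
Proof.
move=> d0 /forallP bt; rewrite /frequent occ_subst.
have := bt (inl i); have := bt (inr true); have := bt (inr false).
rewrite /unbalanced card_sum card_ord card_bool; move: (occ _ _) (occ _ _) (occ _ _) => x y z.
rewrite !negb_or -!ltnNge.
move: (n + 2)%N => m /andP[a1 a2] /andP[b1 b2] /andP[c1 c2].
by case: (k == i); case: (rev_ord k == i); rewrite ?mul0n ?mul1n /=; apply/idP; nia.
Qed.

(** The test [i <= rev_ord i] selects one letter of each opposite pair, so [pick] has a single
    candidate at the points of a balanced template. *)
Definition winning_grid (T : eqType) d n (w : n.+1.-tuple T) (x : gpoint d n.+1) : T :=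
  if [pick i : 'I_n.+1 | (i <= rev_ord i)%N && frequent x i] is Some i
  then tnth w (if odd (count_lower x) then i else rev_ord i) else tnth w ord0.

Lemma winning_grid_subst (T : eqType) d n (w : n.+1.-tuple T) (t : template d n.+1) k :
  (0 < d)%N -> balanced t ->
  winning_grid w (subst t k) =
  tnth w (if odd (count_lower (subst t k)) == (k <= rev_ord k)%N then k else rev_ord k).
Proof.
move=> d0 bt; rewrite /winning_grid;
  (* [pick] succeeds: the smaller of [k] and [rev_ord k] is frequent and passes the test. *)
  case: pickP => [i|/(_ (if (k <= rev_ord k)%N then k else rev_ord k))].
  rewrite frequent_subst // => /andP[ii /orP[]/eqP e]; subst i.
    by rewrite ii; case: odd.
  rewrite !rev_ordK in ii *; have [kk|_] := boolP (k <= rev_ord k)%N; last by case: odd.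
  have -> : rev_ord k = k by apply/val_inj/anti_leq; rewrite ii kk.
  by case: odd.
rewrite frequent_subst //; case: ifP => [->|/negbT]; first by rewrite eqxx.
by rewrite -ltnNge rev_ordK eqxx orbT => /ltnW ->.
Qed.

Lemma hits_winning_grid (T : eqType) d n (w : n.+1.-tuple T) (t : template d n.+1) :
  (0 < d)%N -> balanced t ->
  (forall i, tnth w i = tnth w (rev_ord i)) \/ odd (\sum_j moves (t j)) ->
  hits w (winning_grid w) t.
Proof.
move=> d0 bt [pal|].
  apply/orP; left; apply/forallP=> k; rewrite winning_grid_subst //.
  by case: ifP => // _; rewrite -pal.
rewrite sum_moves oddD => om.
(* [e] is the parity of [count_lower] at the points with [k] in the lower half. In the upper half -
   replaces +, which reverses the parity, so the grid reads the whole line forward if [e] holds and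
   backward otherwise. *)
pose e := odd (\sum_j (if t j is inl a then lower_half a else false) + occ t (inr true)).
have H k : winning_grid w (subst t k) = tnth w (if e then k else rev_ord k).
  rewrite winning_grid_subst // count_lower_subst.
  (* The middle letter is its own reverse, so both choices give the same position of [w]. *)
  have [mid|nmid] := eqVneq (rev_ord k) k; first by rewrite mid !if_same.
  rewrite /e /lower_half rev_ordK !oddD; move: om.
  move: (odd (\sum_j _)) (occ t (inr true)) (occ t (inr false)) => a x y.
  case: (ltngtP k (rev_ord k)) => [_|_|/val_inj ek]; last by rewrite -ek eqxx in nmid.
    by rewrite mul1n mul0n /= eqb_id addbF.
  rewrite mul1n mul0n /= eqbF_neg addbF.
  by case: a (odd x) (odd y) => -[] [].
have [et|ef] := boolP e; apply/orP; [left|right]; apply/forallP=> k; rewrite H.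
  by rewrite et.
by rewrite (negPf ef) rev_ordK.
Qed.

(** * Bounds on f(w, d) and the limits *)

Lemma fG_le_fd (T : eqType) d n (w : n.-tuple T) (G : gpoint d n -> T) : (fG w G <= fd w d)%N.
Proof.
have lt : (fG w G < #|{: {set {set gpoint d n}}}|.+1)%N.
  rewrite ltnS -[leqRHS]cardsT -powersetT card_powerset cardsT.
  by rewrite (leq_trans (max_card _)) // ltnW // ltn_expl.
by apply: (@leq_bigmax_cond _ _ _ (Ordinal lt)) => /=; apply/asboolP; exists G.
Qed.

Lemma fd_le (T : eqType) d n (w : n.-tuple T) c b :
  (forall G : gpoint d n -> T, (c * fG w G <= b)%N) -> (c * fd w d <= b)%N.
Proof.
move=> h; apply: (@big_ind _ (fun k => c * k <= b)%N).
- by rewrite muln0.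
- by move=> x y hx hy; rewrite /maxn; case: ifP.
- by move=> k /asboolP[G <-].
Qed.

Lemma double_fd_le (T : eqType) d n (w : n.+2.-tuple T) :
  (2 * fd w d <= (n.+2 + 2) ^ d)%N.
Proof. by apply: fd_le => G; rewrite double_fG -card_template max_card. Qed.

Lemma quadruple_fd_le (T : eqType) d n (w : n.+2.-tuple T) i :
  tnth w i != tnth w (rev_ord i) -> (4 * fd w d <= (n.+2 + 2) ^ d)%N.
Proof.
move=> wi; apply: fd_le => G; apply: leq_trans (card_hits_le G wi).
rewrite -[4%N]/(2 * 2)%N -mulnA double_fG leq_mul2l /=.
apply/subset_leq_card/fintype.subsetP=> t.
by rewrite !inE => /andP[].
Qed.

(** Union bound: each template is a moving hit of the winning grid, has an unbalanced symbol, or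
    violates [P]. Summing over the [n.+2 + 2] symbols turns the square in [card_unbalanced] into a
    cube. *)
Lemma card_template_le_fd (T : eqType) d n (w : n.+2.-tuple T) (P : pred (template d n.+2)) :
  (0 < d)%N ->
  (forall t, P t -> (forall i, tnth w i = tnth w (rev_ord i)) \/ odd (\sum_j moves (t j))) ->
  (d * (n.+2 + 2) ^ d <= d * (2 * fd w d) + 16 * (n.+2 + 2) ^ 3 * (n.+2 + 2) ^ d
     + d * #|[set t | ~~ P t]|)%N.
Proof.
move=> d0 hP; set m := (n.+2 + 2)%N.
pose U c := #|[set t : template d n.+2 | unbalanced t c]|.
have hU : (d * \sum_c U c <= 16 * m ^ 3 * m ^ d)%N.
  rewrite big_distrr /=; apply: (@leq_trans (\sum_(c : 'I_n.+2 + bool) 16 * m ^ 2 * m ^ d)).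
    apply: leq_sum => c _; apply: leq_trans (card_unbalanced d c) _.
    by rewrite card_sum card_ord card_bool.
  by rewrite sum_nat_const card_sum card_ord card_bool -/m; lia.
suff : (m ^ d <= 2 * fd w d + \sum_c U c + #|[set t | ~~ P t]|)%N by nia.
apply: (@leq_trans (2 * fG w (winning_grid (d := d) w) + \sum_c U c
    + #|[set t | ~~ P t]|)); last first.
  by rewrite !leq_add2r leq_mul2l fG_le_fd.
have -> : (\sum_c U c = \sum_(t : template d n.+2) \sum_c unbalanced t c)%N.
  by rewrite exchange_big; apply: eq_bigr => c _; rewrite /U card_setE.
rewrite double_fG !card_setE /m -card_template -sum1_card -!big_split.
apply: leq_sum => t _ /=.
have [Pt|] := boolP (P t); last by rewrite addn1.
have [bt|] := boolP (balanced t); last first.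
  by rewrite negb_forall => /existsP[c]; rewrite negbK (bigD1 c) //= => ->; lia.
rewrite hits_winning_grid ?andbT //; last exact: hP.
(* A template without moving letters has no +, so it is not balanced. *)
suff -> : [exists j, moves (t j)] by [].
apply: contraT => /existsPn nm.
have := forallP bt (inr true); rewrite /unbalanced /occ big1 ?muln0 //= => j _.
by apply/eqP; rewrite eqb0; apply: contra (nm j) => /eqP ->.
Qed.

Local Open Scope classical_set_scope.

Lemma cvg_ratio (R : realType) (f : nat -> nat) (c m K : nat) : (0 < c)%N -> (0 < m)%N ->
  (forall d, c * f d <= m ^ d)%N ->
  (forall d, d * m ^ d <= d * (c * f d) + K * m ^ d)%N ->
  ((fun d : nat => (f d)%:R / (c%:R^-1 * m%:R ^+ d) : R) @ \oo --> (1 : R)).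
Proof.
move=> c0 m0 ub lb.
(* [harmonic d] is 1/(d + 1), and passing from d to d + 1 in the lower bound costs one more [m ^ d],
   hence [K.+1]. *)
have l1 : ((fun d : nat => 1 - K.+1%:R * harmonic d : R) @ \oo --> (1 : R)).
  rewrite -[X in _ --> X]subr0 -[X in 1 - X](mulr0 (K.+1%:R : R)).
  by apply: cvgB; [exact: cvg_cst|apply: cvgMl_tmp; exact: cvg_harmonic].
apply: (squeeze_cvgr _ l1 (cvg_cst (1 : R))); near=> d.
have mp : 0 < (m%:R ^+ d : R) by rewrite exprn_gt0 // ltr0n.
have -> : (f d)%:R / (c%:R^-1 * m%:R ^+ d) = (c * f d)%:R / m%:R ^+ d :> R.
  by rewrite invfM invrK natrM; ring.
rewrite ler_pdivrMr // mul1r -natrX ler_nat ub andbT ler_pdivlMr ?natrX //.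
rewrite mulrBl mul1r lerBlDr -(@ler_pM2l _ d.+1%:R) ?ltr0n // mulrDr.
rewrite /harmonic [_ / _ * _]mulrAC [X in _ <= _ + X]mulrC divfK ?pnatr_eq0 //.
rewrite -!natrX -!natrM -natrD ler_nat; have := lb d; have := ub d; nia.
Unshelve. all: end_near.
Qed.

Unset Implicit Arguments.

Theorem theorem6 (R : realType) (T : eqType) (n : nat) (w : n.-tuple T) :
  (2 <= n)%N ->
  ((forall i : 'I_n, tnth w i = tnth w (rev_ord i)) ->
     (fun d : nat => (fd w d)%:R / (2^-1 * (n + 2)%:R ^+ d) : R) @ \oo --> (1 : R)) /\
  (~ (forall i : 'I_n, tnth w i = tnth w (rev_ord i)) ->
     (fun d : nat => (fd w d)%:R / (4^-1 * (n + 2)%:R ^+ d) : R) @ \oo --> (1 : R)).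
Proof.
case: n w => [|[|n]] w // _; split=> [pal|npal].
  apply: (@cvg_ratio R (fd w) 2 (n.+2 + 2) (16 * (n.+2 + 2) ^ 3)) => // d.
    exact: double_fd_le.
  case: (posnP d) => [-> //|d0].
  have := @card_template_le_fd T d n w xpredT d0 (fun _ _ => or_introl pal).
  by rewrite [X in (_ + d * X)%N](_ : _ = 0%N) ?muln0 ?addn0 // card_setE big1.
have [i wi] : exists i, tnth w i != tnth w (rev_ord i).
  by apply/existsP; apply: contra_notT npal => /existsPn h i; apply/eqP/negbNE/h.
(* Doubling [card_template_le_fd] turns 16 into 32; the summand [n] comes from [mul_exp_le], applied
   to the parity excess [n ^ d]. *)
apply: (@cvg_ratio R (fd w) 4 (n.+2 + 2) (32 * (n.+2 + 2) ^ 3 + n)) => // d.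
  exact: quadruple_fd_le wi.
case: (posnP d) => [-> //|d0].
have := @card_template_le_fd T d n w (fun t => odd (\sum_j moves (t j))) d0
  (fun _ => @or_intror _ _).
have := card_even_moves d n; have := mul_exp_le n d.
have -> : (n + 4 = n.+2 + 2)%N by lia.
set E := #|_|; move: ((n.+2 + 2) ^ d)%N ((n.+2 + 2) ^ 3)%N (n ^ d)%N (fd w d) => M M3 N F; nia.
Qed.
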